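(* Let $K$ be a complete non-Archimedean field containing $\mathbb{Q}_p$, with valuation ring $\mathcal{O}_K$ and residue field $\kappa$. Let $\phi\in K(z)$ be a rational map with strict good reduction (i.e., the reduction $\overline{\phi}$ has the same degree as $\phi$), and let $F:\kappa\to\kappa$ be a discrete rule (a map). Extend $F$ to $\mathbb{P}^1(\kappa)$ by setting $F(\infty)=\infty$. Then $\phi$ interprets $F$ with inclusion at depth $N=1$ (i.e., on the residue field $\kappa$) if and only if the reduction $\overline{\phi}$ coincides with $F$ as maps on $\mathbb{P}^1(\kappa)$.
   Context: A rational map $\phi\in K(z)$ has strict good reduction if it admits a representation with coefficients in $\mathcal{O}_K$ whose reduction $\overline{\phi}$ over $\kappa$ has the same degree as $\phi$; equivalently, $\phi$ extends to a morphism $\mathbb{P}^1_{\mathcal{O}_K}\to\mathbb{P}^1_{\mathcal{O}_K}$ of the same degree on the special fiber, and $\overline{\phi}:\mathbb{P}^1_\kappa\to\mathbb{P}^1_\kappa$ is the induced map. Let $\pi_1:\mathcal{O}_K\to\kappa$ be the reduction map to the residue field (reduction modulo $p$ when $K$ is unramified over $\mathbb{Q}_p$). The map $\phi$ interprets $F$ with inclusion at depth $1$ if $\phi(\pi_1^{-1}(x))\subseteq\pi_1^{-1}(F(x))$ for every $x\in\kappa$.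
   Formalization: As stated, interpreting F on κ does not force φ̄(∞)=∞ (e.g. φ=1/(z²+z+1), F=1, K=Q_2); the formal theorem proves instead: interprets F on κ iff φ̄=F on κ, and inclusion at every point of P¹(κ), ∞ included, iff φ̄=F on P¹(κ). *)

(* Defs.v *)
From HB Require Import structures.
From mathcomp Require Import all_boot all_order all_algebra.
From mathcomp Require Import boolp classical_sets reals.
Set Implicit Arguments.
Unset Strict Implicit.
Unset Printing Implicit Defensive.
Import Order.TTheory GRing.Theory Num.Theory.
Local Open Scope ring_scope.
Local Open Scope classical_set_scope.

(** * Non-Archimedean fields *)

Record nonarch_abs (R : realType) (K : fieldType) := NonarchAbs {
  nabs :> K -> R;
  nabs_ge0 : forall x, 0 <= nabs x;
  nabs_eq0 : forall x, nabs x = 0 -> x = 0;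
  nabsM : forall x y, nabs (x * y) = nabs x * nabs y;
  nabs1 : nabs 1 = 1;
  nabsD : forall x y, nabs (x + y) <= Num.max (nabs x) (nabs y) }.

Definition nabs_complete (R : realType) (K : fieldType)
    (v : nonarch_abs R K) : Prop :=
  forall u : nat -> K,
    (forall e : R, 0 < e ->
       exists N, forall m n, (N <= m)%N -> (N <= n)%N -> v (u m - u n) < e) ->
    exists l, forall e : R, 0 < e ->
       exists N, forall n, (N <= n)%N -> v (u n - l) < e.

Definition padic_abs (R : realType) (p : nat) (q : rat) : R :=
  if q == 0 then 0
  else p%:R ^ ((logn p `|denq q|%N)%:Z - (logn p `|numq q|%N)%:Z).

(* [L] is the completion of the rationals for the p-adic absolute value;
   this determines the valued field [L] up to a unique isometric isomorphism. *)
Definition is_Qp (R : realType) (p : nat) (L : fieldType)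
    (w : nonarch_abs R L) : Prop :=
  [/\ nabs_complete w,
      (forall q : rat, w (ratr q) = padic_abs R p q) &
      (forall (x : L) (e : R), 0 < e -> exists q : rat, w (x - ratr q) < e)].

(* The absolute value of [K] is normalised so as to extend that of Q_p. *)
Definition contains_Qp (R : realType) (p : nat) (K : fieldType)
    (v : nonarch_abs R K) : Prop :=
  exists (L : fieldType) (w : nonarch_abs R L) (iota : {rmorphism L -> K}),
    is_Qp p w /\ (forall x, v (iota x) = w x).

(** * Valuation ring and residue field *)

Definition valuation_pred (R : realType) (K : fieldType)
  (v : nonarch_abs R K) : {pred K} := fun x => v x <= 1.

Section ValuationRing.
Variables (R : realType) (K : fieldType) (v : nonarch_abs R K).

Lemma nabsN x : v (- x) = v x.
Proof.
have vN1 : v (-1) = 1.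
  apply/eqP; rewrite -(@eqrXn2 _ 2) ?nabs_ge0 // expr1n expr2 -nabsM.
  by rewrite mulrNN mulr1 nabs1.
by rewrite -mulN1r nabsM vN1 mul1r.
Qed.

Lemma valuation_subring : subring_closed (valuation_pred v).
Proof.
split; rewrite /valuation_pred.
- by rewrite unfold_in nabs1.
- move=> x y; rewrite !unfold_in => vx vy.
  by apply: le_trans (nabsD v _ _) _; rewrite ge_max nabsN vx.
- by move=> x y; rewrite !unfold_in nabsM => vx vy; rewrite mulr_ile1 ?nabs_ge0.
Qed.

HB.instance Definition _ :=
  GRing.isSubringClosed.Build K (valuation_pred v) valuation_subring.

Record valuation_ring := ValuationRing {
  vring_val :> K;
  _ : vring_val \in valuation_pred v }.

HB.instance Definition _ := [isSub for vring_val].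
HB.instance Definition _ := [Choice of valuation_ring by <:].
HB.instance Definition _ := [SubChoice_isSubComNzRing of valuation_ring by <:].

End ValuationRing.

(* (kappa, pi) is the quotient of the valuation ring by its maximal ideal
   {z | |z| < 1}, up to a unique isomorphism. *)
Definition is_residue_map (R : realType) (K : fieldType) (v : nonarch_abs R K)
    (kappa : fieldType) (pi : {rmorphism valuation_ring v -> kappa}) : Prop :=
  (forall a : kappa, exists z, pi z = a) /\
  (forall z, pi z = 0 <-> v (val z) < 1).

(** * The projective line and rational maps *)

(* [Some z] is the point [z : 1] and [None] is the point at infinity. *)
Definition P1 (k : fieldType) : Type := option k.

Section RationalMaps.
Variable k : fieldType.

(* The rational map [P : Q] of P^1, for (P, Q) <> (0, 0).  It is evaluated after
   clearing common factors.  The case Q = 0 is the constant map infinity. *)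
Definition lowest_num (P Q : {poly k}) : {poly k} := P %/ gcdp P Q.
Definition lowest_den (P Q : {poly k}) : {poly k} := Q %/ gcdp P Q.

Definition pair_degree (P Q : {poly k}) : nat :=
  maxn (size (lowest_num P Q)).-1 (size (lowest_den P Q)).-1.

(* At infinity = [1 : 0], the value is given by the coefficients of degree
   [pair_degree P Q] of the two homogenised forms. *)
Definition pair_map (P Q : {poly k}) (z : P1 k) : P1 k :=
  let N := lowest_num P Q in
  let D := lowest_den P Q in
  let ab := match z with
            | Some x => (N.[x], D.[x])
            | None => (N`_(pair_degree P Q), D`_(pair_degree P Q))
            end in
  if ab.2 == 0 then None else Some (ab.1 / ab.2).

Definition rat_degree (phi : {fraction {poly k}}) : nat :=
  pair_degree \n_(repr phi) \d_(repr phi).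

Definition rat_map (phi : {fraction {poly k}}) : P1 k -> P1 k :=
  pair_map \n_(repr phi) \d_(repr phi).

End RationalMaps.

Section Interpretation.
Variables (R : realType) (K : fieldType) (v : nonarch_abs R K).
Variables (kappa : fieldType) (pi : {rmorphism valuation_ring v -> kappa}).

Local Notation OK := (valuation_ring v).

(* phi = P / Q with P, Q over the valuation ring, and the reduced map
   [P mod m : Q mod m] is defined and has the same degree as phi. *)
Definition strict_good_representation
    (phi : {fraction {poly K}}) (P Q : {poly OK}) : Prop :=
  let PK := map_poly (val : OK -> K) P in
  let QK := map_poly (val : OK -> K) Q in
  [/\ QK != 0,
      phi = FracField.tofrac PK / FracField.tofrac QK,
      (map_poly pi P != 0) || (map_poly pi Q != 0) &
      pair_degree (map_poly pi P) (map_poly pi Q) = rat_degree phi].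

Definition reduced_map (P Q : {poly OK}) : P1 kappa -> P1 kappa :=
  pair_map (map_poly pi P) (map_poly pi Q).

(* The fibre of the reduction map P^1(K) -> P^1(kappa): over a finite point [a]
   it is pi^-1(a), viewed in P^1(K); over infinity it is the complement of the
   valuation ring. *)
Definition residue_class (x : P1 kappa) : set (P1 K) :=
  match x with
  | Some a => [set Some (val z) | z in pi @^-1` [set a]]
  | None => ~` [set Some (val z) | z in [set: OK]]
  end.

Definition interprets_incl (phi : {fraction {poly K}}) (F : kappa -> kappa) :
    Prop :=
  forall x : kappa,
    rat_map phi @` residue_class (Some x) `<=` residue_class (Some (F x)).

(* The same condition for a rule on P^1(kappa), including the point at
   infinity. *)
Definition interprets_incl_P1
    (phi : {fraction {poly K}}) (G : P1 kappa -> P1 kappa) : Prop :=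
  forall x : P1 kappa,
    rat_map phi @` residue_class x `<=` residue_class (G x).

End Interpretation.

(* F extended to P^1(kappa) by F(infinity) = infinity. *)
Definition extend_rule (kappa : fieldType) (F : kappa -> kappa) :
  P1 kappa -> P1 kappa := omap F.

(* Main.v *)
Require Import Defs.
From mathcomp Require Import all_boot all_order all_algebra.
From mathcomp Require Import boolp classical_sets reals.
Local Open Scope ring_scope.

(** Reduction commutes with a map of good reduction: if [y] in P^1(K) reduces to
    [x], then phi(y) reduces to the value of the reduced map at [x]
    ([rat_map_reduces]).  So phi sends the residue class of [x] into that of the
    reduced value, and since residue classes are nonempty and pairwise disjoint
    this value names the only class that can contain the image
    ([inclusion_iff]).  Both equivalences follow, point by point.

    To see that reduction commutes with phi, write phi = N / D in lowest terms
    over K and scale (N, D) so that its coefficients are integral and not all of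
    them reduce to 0 ([primitive_scaling]).  The given representation (P, Q) may
    have common factors, but N Q = D P over the valuation ring.  Reducing this
    identity and cancelling gives red(N) = h n0 and red(D) = h d0, where n0 / d0
    is the lowest form of red(P) / red(Q) ([coprimep_proportional]).  Strict good
    reduction makes max(deg n0, deg d0) equal to d = max(deg N, deg D), which
    forces h to be a nonzero constant.  Hence (N, D) reduces to a coprime pair of
    the same degree, and its homogeneous values at a primitive representative of
    any point of P^1(K) are integral and not both of absolute value less than 1
    ([hom_eval_reduction], [hom_eval_neq0]).  For such a pair (a, b) the point
    [a : b] reduces to [pi a : pi b] ([residue_class_proj]). *)

Set Implicit Arguments.
Unset Strict Implicit.
Unset Printing Implicit Defensive.
Import Order.TTheory GRing.Theory Num.Theory.

(** * Homogeneous evaluation of pairs of polynomials *)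

Definition proj_point (k : fieldType) (ab : k * k) : P1 k :=
  if ab.2 == 0 then None else Some (ab.1 / ab.2).

(** The degree-[d] homogenisations of [N] and [D], at [x : 1] or at [1 : 0].
    Keeping both coordinates, rather than their quotient, is what allows them to
    be reduced separately. *)
Definition hom_eval (k : nzRingType) (d : nat) (N D : {poly k}) (z : option k) :
    k * k :=
  match z with
  | Some x => (N.[x], D.[x])
  | None => (N`_d, D`_d)
  end.

Lemma pair_mapE (k : fieldType) (P Q : {poly k}) z :
  pair_map P Q z =
  proj_point (hom_eval (pair_degree P Q) (lowest_num P Q) (lowest_den P Q) z).
Proof. by case: z. Qed.

Lemma proj_point_scale (k : fieldType) (c a b : k) :
  c != 0 -> proj_point (c * a, c * b) = proj_point (a, b).
Proof.
move=> c0; rewrite /proj_point /= mulf_eq0 (negPf c0) /=.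
by case: eqP => // _; rewrite -mulf_div divff // mul1r.
Qed.

Lemma hom_eval_scale (k : fieldType) d (c : k) (N D : {poly k}) z :
  hom_eval d (c *: N) (c *: D) z =
  (c * (hom_eval d N D z).1, c * (hom_eval d N D z).2).
Proof. by case: z => [x|] /=; rewrite ?hornerZ ?coefZ. Qed.

Lemma hom_eval_map (A k : nzRingType) (f : {rmorphism A -> k}) d
    (N D : {poly A}) z :
  hom_eval d (map_poly f N) (map_poly f D) (omap f z) =
  (f (hom_eval d N D z).1, f (hom_eval d N D z).2).
Proof. by case: z => [x|] /=; rewrite ?horner_map ?coef_map. Qed.

(** The form of degree [d] attached to [N], written in the coordinate at
    infinity: its value at 0 is [N`_d]. *)
Definition reverse_poly (k : nzRingType) d (N : {poly k}) : {poly k} :=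
  \poly_(i < d.+1) N`_(d - i).

Lemma horner_reverse (k : fieldType) d (N : {poly k}) y :
  (size N <= d.+1)%N -> y != 0 ->
  N.[y] = y ^+ d * (reverse_poly d N).[y^-1].
Proof.
move=> sN y0; rewrite (horner_coef_wide _ sN) horner_poly mulr_sumr.
rewrite (reindex_inj rev_ord_inj) /=; apply: eq_bigr => i _.
rewrite subSS mulrCA; congr (_ * _).
by rewrite exprVn exprB ?unitfE // -ltnS.
Qed.

Lemma map_reverse (A k : nzRingType) (f : {rmorphism A -> k}) d (N : {poly A}) :
  map_poly f (reverse_poly d N) = reverse_poly d (map_poly f N).
Proof.
apply/polyP => i; rewrite coef_map [in LHS]coef_poly [in RHS]coef_poly coef_map /=.
by case: ifP; rewrite ?rmorph0.
Qed.

(** * Coprime pairs and lowest terms *)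

(** Passing from [max (deg N, deg D)] back to sizes is safe because a coprime
    pair is not (0, 0): a zero entry forces the other to be a nonzero constant. *)
Lemma coprimep_max_size (k : fieldType) (N D : {poly k}) :
  coprimep N D ->
  (size N == (maxn (size N).-1 (size D).-1).+1)
  || (size D == (maxn (size N).-1 (size D).-1).+1).
Proof.
have [->|N0] := eqVneq N 0.
  by rewrite coprime0p size_poly0 max0n => /eqp_size ->; rewrite size_poly1.
have [->|D0] := eqVneq D 0.
  by rewrite coprimep0 size_poly0 maxn0 => /eqp_size ->; rewrite size_poly1.
move: N0 D0; rewrite -!size_poly_gt0 => N0 D0 _.
by case: leqP => _; rewrite prednK ?eqxx ?orbT.
Qed.

(** The two homogenised forms have no common zero on P^1: a finite one would be
    a common root, and at infinity one of the values is a leading coefficient. *)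
Lemma hom_eval_neq0 (k : fieldType) (N D : {poly k}) z :
  coprimep N D ->
  let ab := hom_eval (maxn (size N).-1 (size D).-1) N D z in
  (ab.1 != 0) || (ab.2 != 0).
Proof.
move=> cop; case: z => [x|] /=.
  case: (boolP (root N x)) => [/(coprimep_root cop) ->|]; first by rewrite orbT.
  by rewrite rootE => ->.
have top (p : {poly k}) m : size p = m.+1 -> p`_m != 0.
  by move=> sp; rewrite -[m]/(m.+1.-1) -sp -lead_coefE lead_coef_eq0 -size_poly_eq0 sp.
by have /orP[/eqP/top ->|/eqP/top ->] := coprimep_max_size cop; rewrite ?orbT.
Qed.

(** By Gauss's lemma both [n] divides [N] and [d] divides [D]; the two quotients
    agree, and either of [n], [d] that is nonzero can be cancelled to see it. *)
Lemma coprimep_proportional (k : fieldType) (N D n d : {poly k}) :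
  coprimep n d -> N * d = D * n -> exists h, N = h * n /\ D = h * d.
Proof.
move=> cop e.
have /divpK eN : n %| N by rewrite -(Gauss_dvdpl _ cop) e dvdp_mull.
have /divpK eD : d %| D.
  by rewrite coprimep_sym in cop; rewrite -(Gauss_dvdpl _ cop) -e dvdp_mull.
have [d0|d0] := eqVneq d 0.
  have n0 : n != 0.
    by apply: contraTneq cop => ->; rewrite d0 coprimep0 eqp_sym eqp0 oner_eq0.
  exists (N %/ n); split=> //; apply: (mulIf n0).
  by rewrite -e -{1}eN mulrAC.
exists (D %/ d); split=> //; apply: (mulIf d0).
by rewrite e -{1}eD mulrAC.
Qed.

Lemma lowest_coprimep (k : fieldType) (P Q : {poly k}) :
  (P != 0) || (Q != 0) -> coprimep (lowest_num P Q) (lowest_den P Q).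
Proof. exact: coprimep_div_gcd. Qed.

Lemma lowest_cross (k : fieldType) (P Q A B : {poly k}) :
  (P != 0) || (Q != 0) ->
  P * B = Q * A -> lowest_num P Q * B = lowest_den P Q * A.
Proof.
move=> PQ0 e; have g0 : gcdp P Q != 0 by rewrite gcdp_eq0 negb_and.
apply: (mulIf g0); rewrite mulrAC divpK ?dvdp_gcdl // e.
by rewrite [RHS]mulrAC divpK ?dvdp_gcdr.
Qed.

(** The chosen representative of a fraction is only determined up to
    cross-multiplication, so this is all that relates it to [A / B]. *)
Lemma repr_tofrac_div (R : idomainType) (phi : {fraction R}) (A B : R) :
  B != 0 -> phi = FracField.tofrac A / FracField.tofrac B ->
  \n_(repr phi) * B = \d_(repr phi) * A.
Proof.
move=> B0 e.
have : phi = (\pi_(FracField.type R) (Ratio A B))%qT.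
  rewrite e; apply: (canLR (mulfK _)).
    by rewrite tofrac_eq0.
  rewrite !piE; apply/eqmodP; rewrite /= FracField.equivfE /FracField.mulf.
  by rewrite !numden_Ratio ?mulf_neq0 ?oner_neq0 ?mulr1 // mul1r.
rewrite -[phi in LHS]reprK => /eqP; rewrite FracField.equivf_def => /eqP.
by rewrite !numden_Ratio.
Qed.

(** * Absolute values and integral scalings *)

Section Reduction.
Variables (R : realType) (K : fieldType) (v : nonarch_abs R K).
Variables (kappa : fieldType) (pi : {rmorphism valuation_ring v -> kappa}).
Hypothesis hpi : is_residue_map pi.
Local Notation OK := (valuation_ring v).

Lemma val_le1 (a : OK) : v (val a) <= 1.
Proof. exact: (valP a). Qed.

Lemma pi_neq0 (a : OK) : (pi a != 0) = (v (val a) == 1).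
Proof.
apply/idP/idP => [|/eqP va].
  apply: contraNT => va; apply/eqP/hpi.2.
  by rewrite lt_neqAle va val_le1.
by apply/eqP => /hpi.2; rewrite va ltxx.
Qed.

(** Multiplicativity leaves only 0 and 1 for the value at 0, and the constant
    function 1 does satisfy the axioms of [nonarch_abs].  It is excluded because
    the residue map sends 0 to 0, so that the value at 0 is less than 1. *)
Lemma nabs0 : v 0 = 0.
Proof.
have := hpi.2 0; rewrite rmorph0 => -[/(_ erefl) /=] v0 _.
have : v 0 = v 0 * v 0 by rewrite -nabsM mulr0.
have [//|n0] := eqVneq (v 0) 0.
move/(congr1 (fun x => x / v 0)); rewrite mulfK // divff // => v1.
by rewrite -v1 ltxx in v0.
Qed.

Lemma nabsV x : x != 0 -> v x^-1 = (v x)^-1.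
Proof.
move=> x0; have e : v x * v x^-1 = 1 by rewrite -nabsM mulfV // nabs1.
have vx : v x != 0 by apply: contraTneq (oner_neq0 R) => vx; rewrite -e vx mul0r eqxx.
by apply: (mulfI vx); rewrite e mulfV.
Qed.

Lemma nabs_gt0 x : x != 0 -> 0 < v x.
Proof.
move=> x0; rewrite lt_neqAle nabs_ge0 andbT eq_sym.
by apply: contraNneq x0 => /nabs_eq0 ->.
Qed.

Lemma integral_lift x : v x <= 1 -> exists a : OK, val a = x.
Proof. by move=> vx; exists (@ValuationRing _ _ v x vx). Qed.

Lemma integral_poly_lift (p : {poly K}) :
  (forall i, v p`_i <= 1) -> exists p' : {poly OK}, map_poly val p' = p.
Proof.
move=> hp; exists (\poly_(i < size p) insubd (0 : OK) p`_i).
apply/polyP => i; rewrite coef_map_id0 ?coef_poly //.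
case: ltnP => [_|/(nth_default 0) -> //].
by rewrite insubdK //; apply: hp.
Qed.

Lemma dominant_entry (s : seq K) :
  has (fun x => x != 0) s ->
  exists c, [/\ c \in s, c != 0 & forall x, x \in s -> v x <= v c].
Proof.
elim: s => //= x s IH.
have [/IH[c [cs c0 cmax]] _|hs] := boolP (has _ s).
  have [le|lt] := leP (v x) (v c).
    exists c; split=> [||y]; rewrite ?inE ?cs ?orbT //.
    by case/orP=> [/eqP ->|/cmax].
  exists x; split=> [||y]; rewrite ?inE ?eqxx //.
    apply: contraTneq lt => ->; rewrite nabs0 -leNgt; exact: nabs_ge0.
  by case/orP=> [/eqP -> //|/cmax /le_trans]; apply; apply: ltW.
rewrite orbF => x0; exists x; split=> [||y]; rewrite ?inE ?eqxx //.
case/orP=> [/eqP -> //|ys].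
move/hasPn: hs => /(_ y ys); rewrite negbK => /eqP ->.
rewrite nabs0; exact: nabs_ge0.
Qed.

(** Dividing by a coefficient of largest absolute value makes all coefficients
    integral and turns that one into 1, whose reduction is nonzero. *)
Lemma primitive_scaling (N D : {poly K}) :
  (N != 0) || (D != 0) ->
  exists c (N' D' : {poly OK}),
    [/\ c != 0, map_poly val N' = c *: N, map_poly val D' = c *: D
      & (map_poly pi N' != 0) || (map_poly pi D' != 0)].
Proof.
move=> ND0.
have /dominant_entry[c [cs c0 cmax]] :
    has (fun x => x != 0) ((N : seq K) ++ (D : seq K)).
  have nz (p : {poly K}) : p != 0 -> has (fun x => x != 0) (p : seq K).
    move=> p0; apply/hasP; exists (lead_coef p); rewrite ?lead_coef_eq0 //.
    by rewrite lead_coefE mem_nth // prednK ?size_poly_gt0.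
  by rewrite has_cat; case/orP: ND0 => /nz ->; rewrite ?orbT.
have lift (p : {poly K}) : {subset (p : seq K) <= (N : seq K) ++ (D : seq K)} ->
    exists p' : {poly OK}, map_poly val p' = c^-1 *: p.
  move=> sub; apply: integral_poly_lift => i.
  rewrite coefZ nabsM nabsV // mulrC ler_pdivrMr ?nabs_gt0 // mul1r.
  have [ip|/(nth_default 0) ->] := ltnP i (size p).
    by apply/cmax/sub/mem_nth.
  by rewrite nabs0 nabs_ge0.
have [|N' eN] := lift N; first by move=> x xN; rewrite mem_cat xN.
have [|D' eD] := lift D; first by move=> x xD; rewrite mem_cat xD orbT.
have unit_coef (p : {poly K}) (p' : {poly OK}) :
    map_poly val p' = c^-1 *: p -> c \in (p : seq K) -> map_poly pi p' != 0.
  move=> e /(nthP 0)[i _ ci]; apply/eqP => /(congr1 (fun q : {poly _} => q`_i)).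
  rewrite coef0 coef_map /= => /eqP; apply/negP; rewrite pi_neq0.
  have := congr1 (fun q : {poly _} => q`_i) e.
  by rewrite coef_map_id0 // coefZ ci mulVf // => ->; rewrite nabs1.
exists c^-1, N', D'; split; rewrite ?invr_neq0 //.
move: cs; rewrite mem_cat => /orP[cN|cD].
  by rewrite (unit_coef _ _ eN cN).
by rewrite (unit_coef _ _ eD cD) orbT.
Qed.

(** * Residue classes and reduction *)

(** If [b] is a unit, [a / b] is integral and reduces to [pi a / pi b].  Otherwise
    [a] is a unit and [b] is not, so [b = 0] or [a / b] has absolute value
    greater than 1, hence lies over infinity. *)
Lemma residue_class_proj (a b : OK) :
  (pi a != 0) || (pi b != 0) ->
  residue_class pi (proj_point (pi a, pi b)) (proj_point (val a, val b)).
Proof.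
rewrite /proj_point /= => ab.
have [pb0|pb0] := eqVneq (pi b) 0.
  rewrite pb0 eqxx orbF pi_neq0 in ab.
  case: eqVneq => [_|b0] /=; first by case=> z.
  case=> z _ [e]; move/hpi.2: pb0; apply/negP; rewrite -leNgt.
  have /(congr1 v) : val a = val z * val b by rewrite /= e divfK.
  rewrite (eqP ab) nabsM => ->.
  by apply: ler_piMl; [apply: nabs_ge0 | apply: val_le1].
have vb : v (val b) = 1 by apply/eqP; rewrite -pi_neq0.
have b0 : val b != 0.
  by apply/eqP => b0; move/eqP: vb; rewrite b0 nabs0 eq_sym oner_eq0.
rewrite (negPf b0) /=.
have [|z ez] := @integral_lift (val a / val b).
  by rewrite nabsM nabsV // vb invr1 mulr1 val_le1.
exists z; last by rewrite ez.
apply: (mulIf pb0); rewrite -rmorphM divfK //; congr (pi _).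
by apply: val_inj; rewrite rmorphM /= ez divfK.
Qed.

Lemma residue_class_nonempty x : exists y, residue_class pi x y.
Proof.
case: x => [a|]; last by exists None; case.
by have [z hz] := hpi.1 a; exists (Some (val z)); exists z.
Qed.

Lemma residue_class_inj x x' y :
  residue_class pi x y -> residue_class pi x' y -> x = x'.
Proof.
case: x x' => [a|] [a'|] //=.
- by move=> [z <- <-] [z' <- [/val_inj ->]].
- by move=> [z _ <-] []; exists z.
- by move=> + [z _ e]; rewrite -e; case; exists z.
Qed.

(** A point of P^1(K) is [z : 1] with [z] integral, or [1 : 0], or [1 : w] with
    [w] nonzero in the maximal ideal.  In the first two cases the homogeneous
    values are already integral.  In the third, [y = 1 / w], the common factor is
    [y ^+ d] and what remains is the value of the reversed polynomials at [w],
    which reduces to their value at 0, the coefficient of degree [d]. *)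
Lemma hom_eval_reduction d (N D : {poly OK}) x y :
  (size N <= d.+1)%N -> (size D <= d.+1)%N -> residue_class pi x y ->
  exists (a b : OK) c,
    [/\ c != 0,
        hom_eval d (map_poly val N) (map_poly val D) y = (c * val a, c * val b)
      & hom_eval d (map_poly pi N) (map_poly pi D) x = (pi a, pi b)].
Proof.
move=> sN sD xy.
have reduces (z : option OK) : x = omap pi z -> y = omap val z ->
    exists (a b : OK) c,
      [/\ c != 0,
          hom_eval d (map_poly val N) (map_poly val D) y = (c * val a, c * val b)
        & hom_eval d (map_poly pi N) (map_poly pi D) x = (pi a, pi b)].
  move=> -> ->; exists (hom_eval d N D z).1, (hom_eval d N D z).2, 1.
  by rewrite oner_neq0 !mul1r !hom_eval_map.
case: x y xy reduces => [x|] y /=.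
  by case=> z <- <- /(_ (Some z)); apply.
case: y => [y|] yP /(_ None) reduces; last exact: reduces.
have vy : 1 < v y.
  rewrite ltNge; apply/negP => vy; apply: yP.
  by have [z <-] := integral_lift vy; exists z.
have y0 : y != 0 by apply: contraTneq vy => ->; rewrite nabs0 ltr10.
have vy1 : v y^-1 < 1 by rewrite nabsV // invf_lt1 ?nabs_gt0.
have [w ew] := integral_lift (ltW vy1).
have w0 : pi w = 0 by apply/hpi.2; rewrite ew.
exists (reverse_poly d N).[w], (reverse_poly d D).[w], (y ^+ d).
have size_val (p : {poly OK}) : (size p <= d.+1)%N ->
    (size (map_poly val p : {poly K}) <= d.+1)%N.
  exact: leq_trans (size_poly _ _).
rewrite expf_neq0 // /hom_eval; split=> //.
  rewrite (horner_reverse (size_val _ sN) y0) (horner_reverse (size_val _ sD) y0).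
  by rewrite -!map_reverse -ew !horner_map.
by rewrite -!horner_map !map_reverse w0 !horner_coef0 !coef_poly subn0.
Qed.

(** The scaled lowest form of phi reduces to a constant multiple of the lowest
    form of [P : Q] modulo the maximal ideal, so both maps can be read off from
    the same pair of integral homogeneous values. *)
Lemma rat_map_reduces phi (P Q : {poly OK}) x y :
  strict_good_representation pi phi P Q ->
  residue_class pi x y ->
  residue_class pi (reduced_map pi P Q x) (rat_map phi y).
Proof.
case=> Q0 ephi PQ0 degE xy.
set N := lowest_num \n_(repr phi) \d_(repr phi).
set D := lowest_den \n_(repr phi) \d_(repr phi).
have phi0 : (\n_(repr phi) != 0) || (\d_(repr phi) != 0).
  by rewrite denom_ratioP orbT.
have copND : coprimep N D := lowest_coprimep phi0.
have cross : N * map_poly val Q = D * map_poly val P.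
  exact: lowest_cross (repr_tofrac_div Q0 ephi).
have ND0 : (N != 0) || (D != 0).
  apply: contraTT copND; rewrite negb_or !negbK => /andP[/eqP -> /eqP ->].
  by rewrite coprimep0 eqp_sym eqp0 oner_eq0.
have [c [N' [D' [c0 eN eD red0]]]] := primitive_scaling ND0.
set d := rat_degree phi.
have dE : d = maxn (size N).-1 (size D).-1 by [].
have sizeE (p : {poly K}) (p' : {poly OK}) :
    map_poly val p' = c *: p -> size p' = size p.
  by move=> e; rewrite -(size_scale p c0) -e size_map_inj_poly //; apply: val_inj.
have sN : (size N' <= d.+1)%N.
  by rewrite (sizeE _ _ eN) dE (leq_trans (leqSpred _)) // ltnS leq_maxl.
have sD : (size D' <= d.+1)%N.
  by rewrite (sizeE _ _ eD) dE (leq_trans (leqSpred _)) // ltnS leq_maxr.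
have crossO : N' * Q = D' * P.
  apply: (map_inj_poly (val_inj : injective (val : OK -> K))) => //.
  by rewrite !rmorphM /= eN eD -!scalerAl cross.
set n0 := lowest_num (map_poly pi P) (map_poly pi Q).
set d0 := lowest_den (map_poly pi P) (map_poly pi Q).
have cop0 : coprimep n0 d0 := lowest_coprimep PQ0.
have crossk : map_poly pi N' * d0 = map_poly pi D' * n0.
  rewrite mulrC [RHS]mulrC; apply/esym/lowest_cross => //.
  by rewrite -!rmorphM mulrC -crossO mulrC.
have [h [hN hD]] := coprimep_proportional cop0 crossk.
have h0 : h != 0.
  by apply: contraTneq red0 => h0; rewrite hN hD h0 !mul0r eqxx.
(* N' and D' have degree at most d, and n0 or d0 has degree exactly d, so their
   common factor h has degree 0. *)
have [e e0 he] : exists2 e, e != 0 & h = e%:P.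
  suff /size_poly1P[e e0 ->] : size h == 1%N by exists e.
  have bound (q : {poly kappa}) : size q = d.+1 -> (size (h * q)%R <= d.+1)%N ->
      size h == 1%N.
    move=> sq; rewrite size_mul // -?size_poly_gt0 ?sq //.
    rewrite addnS /= -[X in (_ <= X)%N]add1n leq_add2r => sh.
    by rewrite eqn_leq sh size_poly_gt0.
  have := coprimep_max_size cop0.
  rewrite -[maxn _ _]/(pair_degree _ _) degE => /orP[] /eqP /bound; apply.
    by rewrite -hN; apply: leq_trans sN; apply: size_poly.
  by rewrite -hD; apply: leq_trans sD; apply: size_poly.
have [a [b [g [g0 evK evk]]]] := hom_eval_reduction sN sD xy.
have redE : reduced_map pi P Q x = proj_point (pi a, pi b).
  rewrite -evk hN hD he !mul_polyC hom_eval_scale proj_point_scale //.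
  by rewrite -surjective_pairing /reduced_map pair_mapE degE.
have ratE : rat_map phi y = proj_point (val a, val b).
  rewrite -(proj_point_scale _ _ g0) -evK eN eD hom_eval_scale.
  apply/esym/(etrans (proj_point_scale _ _ c0)).
  by rewrite -surjective_pairing /rat_map pair_mapE.
rewrite redE ratE; apply: residue_class_proj.
have := hom_eval_neq0 x cop0; rewrite -[maxn _ _]/(pair_degree _ _) degE /=.
move: evk; rewrite hN hD he !mul_polyC hom_eval_scale -/d => -[<- <-].
by rewrite !mulf_eq0 (negPf e0).
Qed.

Lemma inclusion_iff phi (P Q : {poly OK}) x x' :
  strict_good_representation pi phi P Q ->
  (rat_map phi @` residue_class pi x `<=` residue_class pi x')%classic <->
  reduced_map pi P Q x = x'.
Proof.
move=> good; split=> [incl|<- _ [y xy <-]]; last exact: rat_map_reduces.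
have [y xy] := residue_class_nonempty x.
apply: residue_class_inj (rat_map_reduces good xy) (incl _ _).
by exists y.
Qed.

End Reduction.

(** * The equivalences *)

Theorem lemma7p26 (R : realType) (p : nat) (hp : prime p)
    (K : fieldType) (v : nonarch_abs R K)
    (hcomplete : nabs_complete v) (hQp : contains_Qp p v)
    (kappa : fieldType) (pi : {rmorphism valuation_ring v -> kappa})
    (hpi : is_residue_map pi)
    (phi : {fraction {poly K}}) (P Q : {poly valuation_ring v})
    (hphi : strict_good_representation pi phi P Q)
    (F : kappa -> kappa) :
  (interprets_incl pi phi F <->
     forall x : kappa, reduced_map pi P Q (Some x) = extend_rule F (Some x))
  /\
  (interprets_incl_P1 pi phi (extend_rule F) <->
     forall x : P1 kappa, reduced_map pi P Q x = extend_rule F x).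
Proof.
by split; split=> h x; apply/(inclusion_iff hpi _ _ hphi); apply: h.
Qed.
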